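(* For every odd positive integer $d$ and every sufficiently large $n$ (depending on $d$) there is a smooth quartic hypersurface $H_d^n\subset\mathbb P^{n+1}$ over $K=\mathbb Q(t)$ such that $H_d^n$ has a point in a field extension of $K$ of degree $d$, but $H_d^n$ does not have a point in any field extension of $K$ of odd degree smaller than $d$.
   Context: ''Has a point in a field extension $L/K$'' means $H_d^n(L)\neq\emptyset$. *)

(* Defs.v *)
From HB Require Import structures.
From mathcomp Require Import all_boot all_order all_algebra all_field.
From mathcomp Require Import mpoly.

Set Implicit Arguments.
Unset Strict Implicit.
Unset Printing Implicit Defensive.

Import GRing.Theory.
Local Open Scope ring_scope.

Definition Qt : fieldType := {fraction {poly rat}}.

(* An L-point of the hypersurface V(F) in projective (m-1)-space, given by
   homogeneous coordinates v, not all zero; F is a form over K in m variables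
   and iota makes L a field extension of K. *)
Definition is_point (K L : fieldType) (iota : {rmorphism K -> L}) (m : nat)
    (F : {mpoly K[m]}) (v : 'I_m -> L) : Prop :=
  (exists i, v i != 0) /\ (map_mpoly iota F).@[v] = 0.

Definition has_point (K : fieldType) (L : fieldExtType K) (m : nat)
    (F : {mpoly K[m]}) : Prop :=
  exists v : 'I_m -> L, is_point (in_alg L) F v.

(* V(F) is a hypersurface of degree e, smooth over K by the Jacobian criterion:
   at every geometric point some partial derivative of F is nonzero. *)
Definition smooth_hypersurface (K : fieldType) (m e : nat)
    (F : {mpoly K[m]}) : Prop :=
  [/\ F != 0, F \is e.-homog &
      forall (C : closedFieldType) (iota : {rmorphism K -> C}) (v : 'I_m -> C),
        is_point iota F v ->
        exists i : 'I_m, (map_mpoly iota (F^`M(i))).@[v] != 0].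

(* Main.v *)
(** Write A = Q[X]/(f) with f of degree d, irreducible over Q and totally real, and let x_i, y_i be
    the conjugates of two generic elements x, y of A.  The quartic
      Tr(x^2)^2 - Tr(x^4) + Tr(y^4) + t Tr(x^3 y) + (a Fermat tail)
    vanishes at the idempotents of A, that is, at d conjugate points with y = 0.
    At t = 0 it is sum_(i <> j) x_i^2 x_j^2 + sum_i y_i^4 + ..., whose only real zeros are these
    points.  Given a zero over an extension of Q(t) of odd degree m < d, specialise t to small
    positive reals: since m is odd the zero specialises to real zeros, and these accumulate at the
    idempotents.  But m < d forces a nontrivial relation Tr(c x) = 0 with c in A(t), which
    at t = 0 contradicts the irreducibility of f.
    Smoothness: in the conjugate coordinates a singular point makes t algebraic over Q. *)

Require Import Defs.
From mathcomp Require Import all_boot all_order all_algebra all_field.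
From mathcomp Require Import mpoly polyrcf realalg zify ring lra.

Set Implicit Arguments.
Unset Strict Implicit.
Unset Printing Implicit Defensive.

Import Order.TTheory GRing.Theory Num.Theory.
Local Open Scope ring_scope.

(** * The trace form *)

(* The sum of the k-th powers of the roots of f: by Lagrange interpolation, the coefficient
   of degree (deg f) - 1 in g f' modulo f is the sum of g over the roots. *)
Definition psum (f : {poly int}) (k : nat) : int :=
  (Pdiv.Ring.rmodp ('X^k * f^`()) f)`_(size f).-2.

(** For monic f this is the trace from S[X]/(f) to S. Writing it linearly in the coefficients, with
    integer weights, makes it available over every ring and compatible with ring morphisms. *)
Definition ptrace (f : {poly int}) (S : nzRingType) (g : {poly S}) : S :=
  \sum_(k < size g) g`_k *~ psum f k.

Lemma ptrace_widen (f : {poly int}) (S : nzRingType) (g : {poly S}) n :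
  (size g <= n)%N -> ptrace f g = \sum_(k < n) g`_k *~ psum f k.
Proof.
move=> le_gn; rewrite /ptrace (big_ord_widen n (fun k => g`_k *~ psum f k)) //.
rewrite big_mkcond; apply: eq_bigr => k _; case: ltnP => // le_gk.
by rewrite nth_default // mul0rz.
Qed.

Lemma ptraceD (f : {poly int}) (S : nzRingType) (g h : {poly S}) :
  ptrace f (g + h) = ptrace f g + ptrace f h.
Proof.
pose n := maxn (size g) (size h).
rewrite !(@ptrace_widen f _ _ n) ?leq_maxl ?leq_maxr ?(leq_trans (size_polyD _ _)) //.
by rewrite -big_split; apply: eq_bigr => k _; rewrite coefD mulrzDl.
Qed.

Lemma ptraceZ (f : {poly int}) (S : nzRingType) (a : S) (g : {poly S}) :
  ptrace f (a *: g) = a * ptrace f g.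
Proof.
rewrite (@ptrace_widen f _ (a *: g) (size g)) ?size_scale_leq // /ptrace mulr_sumr.
by apply: eq_bigr => k _; rewrite coefZ mulrzAr.
Qed.

Lemma ptrace0 (f : {poly int}) (S : nzRingType) : ptrace f (0 : {poly S}) = 0.
Proof. by rewrite /ptrace size_poly0 big_ord0. Qed.

Lemma ptrace_map (f : {poly int}) (S S' : nzRingType) (h : {rmorphism S -> S'})
    (g : {poly S}) : ptrace f (map_poly h g) = h (ptrace f g).
Proof.
rewrite (@ptrace_widen f _ _ (size g)) ?size_poly // /ptrace rmorph_sum.
by apply: eq_bigr => k _; rewrite coef_map rmorphMz.
Qed.

(** By linearity it suffices to treat monomials, where division by the monic f over the integers
    commutes with passage to F. *)
Lemma ptrace_modp (f : {poly int}) (F : fieldType) (g : {poly F}) :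
  f \is monic ->
  ptrace f g = ((g * map_poly intr f^`()) %% map_poly intr f)`_(size f).-2.
Proof.
move=> fmon; pose fF := map_poly intr f : {poly F}.
have szF : size fF = size f by rewrite size_map_poly_id0 // (monicP fmon) oner_neq0.
have psumE k : (psum f k)%:~R = (('X^k * map_poly intr f^`()) %% fF)`_(size f).-2.
  rewrite /psum; set r := Pdiv.Ring.rmodp _ _.
  have -> : ('X^k * map_poly intr f^`()) %% fF = map_poly intr r.
    apply/esym/(@modpP _ _ (map_poly intr (Pdiv.Ring.rdivp ('X^k * f^`()) f))).
      by rewrite -rmorphM -rmorphD -Pdiv.RingMonic.rdivp_eq // rmorphM /= map_polyXn.
    rewrite szF (leq_ltn_trans (size_poly _ _)) // Pdiv.Ring.ltn_rmodpN0 //.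
    exact: monic_neq0.
  by rewrite coef_map.
rewrite -[in RHS](coefK g) poly_def mulr_suml.
rewrite (big_morph (fun h => h %% fF) (modpD fF) (mod0p fF)) coef_sum.
apply: eq_bigr => k _.
by rewrite -scalerAl modpZl coefZ -psumE mulrzr.
Qed.

Lemma map_intr_monic (f : {poly int}) (F : nzRingType) :
  f \is monic -> map_poly (intr : int -> F) f \is monic.
Proof. exact: monic_map. Qed.

(** Lagrange interpolation: with q_a = f/(X - a) one has f'(a) = q_a(a), so g f' modulo f equals
    sum_a g(a) q_a, both sides having degree below deg f and the same values at the roots. Each q_a
    is monic of degree deg f - 1, so the top coefficient is sum_a g(a). *)
Lemma ptrace_roots (f : {poly int}) (F : fieldType) (g : {poly F}) (r : seq F) :
  uniq r -> (0 < size r)%N -> f \is monic ->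
  map_poly intr f = \prod_(a <- r) ('X - a%:P) ->
  ptrace f g = \sum_(a <- r) g.[a].
Proof.
move=> r_uniq r_gt0 fmon fE; rewrite ptrace_modp //.
set fF := map_poly intr f in fE *.
have szF : size fF = size f by rewrite size_map_poly_id0 // (monicP fmon) oner_neq0.
have szr : size f = (size r).+1 by rewrite -szF fE size_prod_XsubC.
rewrite -deriv_map -/fF.
pose q a := fF %/ ('X - a%:P).
have rootF a : a \in r -> root fF a by rewrite fE root_prod_XsubC.
have qE a : a \in r -> fF = q a * ('X - a%:P).
  by move=> /rootF; rewrite -dvdp_XsubCl /q => /divpK ->.
have qmon a : a \in r -> q a \is monic.
  move=> ar; have : fF \is monic by exact: map_intr_monic.
  by rewrite (qE a ar) monicMr ?monicXsubC.
have szq a : a \in r -> size (q a) = size r.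
  move=> ar; have := szF; rewrite (qE a ar) size_Mmonic ?monicXsubC ?monic_neq0 ?qmon //.
  by rewrite size_XsubC szr addn2 /= => -[].
have q0 a b : a \in r -> b \in r -> a != b -> (q a).[b] = 0.
  move=> ar br nab; have := rootF b br; rewrite (qE a ar) rootM root_XsubC.
  by rewrite [b == a]eq_sym (negPf nab) orbF => /eqP.
have f'E a : a \in r -> fF^`().[a] = (q a).[a].
  by move=> ar; rewrite {1}(qE a ar) derivM derivXsubC mulr1 !hornerE subrr mulr0 add0r.
have -> : (g * fF^`()) %% fF = \sum_(a <- r) g.[a] *: q a.
  apply/eqP; rewrite -subr_eq0; apply/eqP.
  apply: (@roots_geq_poly_eq0 _ _ r) => //.
    apply/allP => b br; rewrite /root hornerE hornerN horner_sum.
    rewrite (bigD1_seq b) //= big1_seq => [|a /andP[nab ar]]; last first.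
      by rewrite hornerZ q0 ?mulr0.
    have -> : ((g * fF^`()) %% fF).[b] = (g * fF^`()).[b].
      rewrite [in RHS](divp_eq (g * fF^`()) fF) hornerD [(_ * fF).[b]]hornerM.
      by rewrite (rootP (rootF b br)) mulr0 add0r.
    by rewrite hornerZ addr0 hornerM f'E // subrr.
  rewrite (leq_trans (size_polyD _ _)) // geq_max size_polyN; apply/andP; split.
    by rewrite -ltnS -szr -szF ltn_modp monic_neq0 ?map_intr_monic.
  apply: (leq_trans (size_sum _ _ _)); apply/bigmax_leqP_seq => a ar _.
  by rewrite (leq_trans (size_scale_leq _ _)) ?szq.
rewrite coef_sum; apply: eq_big_seq => a ar; rewrite coefZ szr /=.
by rewrite -(szq a ar) -lead_coefE (monicP (qmon a ar)) mulr1.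
Qed.

(* Modulo f one has g q = g(a) q, and the trace of q is f'(a) = q(a). *)
Lemma ptrace_root_quotient (f : {poly int}) (F : fieldType) (q g : {poly F}) (a : F) :
  f \is monic -> map_poly intr f = q * ('X - a%:P) ->
  ptrace f (g * q) = g.[a] * q.[a].
Proof.
move=> fmon fE; rewrite ptrace_modp // -deriv_map.
set fF := map_poly intr f in fE *.
have szF : size fF = size f by rewrite size_map_poly_id0 // (monicP fmon) oner_neq0.
have fFm : fF \is monic by exact: map_intr_monic.
have qmon : q \is monic by move: fFm; rewrite fE monicMr ?monicXsubC.
have szq : size f = (size q).+1.
  by rewrite -szF fE size_Mmonic ?monicXsubC ?monic_neq0 // size_XsubC addn2.
set h := g * _; have hE : h = h + 0 by rewrite addr0.
pose e := g * fF^`().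
have [u eE] : exists u, e = u * ('X - a%:P) + (e.[a])%:P.
  have /factor_theorem[u uE] : root (e - (e.[a])%:P) a.
    by rewrite /root !hornerE subrr.
  by exists u; rewrite -uE subrK.
have -> : (h * fF^`()) %% fF = e.[a] *: q.
  apply/esym/(@modpP _ _ u); last first.
    by rewrite szF szq ltnS size_scale_leq.
  rewrite /h mulrAC -/e fE {1}eE mulrDl mul_polyC; congr (_ + _).
  by rewrite -mulrA [('X - _) * q]mulrC.
rewrite coefZ szq /= -lead_coefE (monicP qmon) mulr1 /e fE derivM derivXsubC !hornerE.
by rewrite subrr mulr0 add0r.
Qed.

(** * A totally real irreducible polynomial *)

(* Eisenstein at 2, and the sign alternates at the points 8 k - 4. *)
Definition fpoly (d : nat) : {poly int} :=
  \prod_(k < d) ('X - ((8 * k)%N%:R)%:P) + 2%:R%:P.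

Lemma size_fpoly d : (0 < d)%N -> size (fpoly d) = d.+1.
Proof.
move=> d_gt0; rewrite /fpoly size_polyDl size_prod_XsubC.
  by rewrite /index_enum -enumT size_enum_ord.
by rewrite (leq_ltn_trans (size_polyC_leq1 _)) // /index_enum -enumT size_enum_ord.
Qed.

Lemma fpoly_monic d : (0 < d)%N -> fpoly d \is monic.
Proof.
move=> d_gt0; rewrite monicE /fpoly lead_coefDl.
  by rewrite -monicE monic_prod_XsubC.
rewrite size_prod_XsubC (leq_ltn_trans (size_polyC_leq1 _)) //.
by rewrite /index_enum -enumT size_enum_ord.
Qed.

Lemma fpoly_irreducible d : (0 < d)%N ->
  irreducible_poly (map_poly intr (fpoly d) : {poly rat}).
Proof.
move=> d_gt0; apply/irreducible_rat_int.
(* All the numbers 8 k are even, so the product is X^d modulo 2. *)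
have prodE : exists g : {poly int},
    \prod_(k < d) ('X - ((8 * k)%N%:R)%:P) = 'X^d + 2%:R%:P * g.
  elim: d {d_gt0} => [|d [g IHd]].
    by exists 0; rewrite big_ord0 mulr0 addr0.
  rewrite big_ord_recr IHd /=.
  exists (- 'X^d * ((4 * d)%N%:R)%:P + g * ('X - ((8 * d)%N%:R)%:P)).
  have -> : (8 * d)%N%:R%:P = 2%:R%:P * ((4 * d)%N%:R)%:P :> {poly int}.
    by rewrite -polyCM -natrM mulnA.
  by rewrite exprSr mulrDl !mulrDr !mulrN mulrCA mulNr mulrN !mulrA !addrA.
apply: (@eisenstein_crit 2) => //; rewrite ?size_fpoly //.
- by rewrite eqSS -lt0n.
- by rewrite (monicP (fpoly_monic d_gt0)).
(* The factor with k = 0 is X, so the constant coefficient of f is 2, which 4 does not divide. *)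
- rewrite /fpoly coefD coefC eqxx -horner_coef0 horner_prod.
  by case: d d_gt0 {prodE} => // d _; rewrite big_ord_recl !hornerE.
move=> i /= lt_id; have [g gE] := prodE.
rewrite /fpoly gE !coefD coefXn coefC coefCM ltn_eqF //.
by case: eqP => _; rewrite add0r ?addr0 ?dvdz_mulr // rpredD ?dvdz_mulr.
Qed.

Lemma fpoly_totally_real d (R : rcfType) : (0 < d)%N ->
  exists r : seq R, [/\ uniq r, size r = d &
    map_poly intr (fpoly d) = \prod_(a <- r) ('X - a%:P)].
Proof.
move=> d_gt0; pose p := map_poly intr (fpoly d) : {poly R}.
pose P (x : int) : int := \prod_(k < d) (x - (8 * k)%N%:R).
have pE (x : int) : p.[x%:~R] = (P x + 2%:R)%:~R.
  rewrite horner_map /= /fpoly hornerD hornerC horner_prod; congr ((_ + _)%:~R).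
  by apply: eq_bigr => k _; rewrite !hornerE.
pose u (k : nat) : int := (8 * k)%N%:Z - 4.
have uS k : u k.+1 = (8 * k)%N%:Z + 4 by rewrite /u mulnS PoszD addrAC addrC.
(* Since [u k] is 4 modulo 8, every factor has absolute value at least 4; hence adding 2 cannot
   change the sign of [P (u k)]. *)
have absP k : 4 <= `|P (u k)|.
  rewrite /P; case: d d_gt0 {p P pE} => // d _.
  have fac (j : nat) : (4 <= `|u k - (8 * j)%N%:R| :> int).
    by rewrite /u natz; lia.
  rewrite normr_prod big_ord_recr /=.
  apply: le_trans (fac d) _; rewrite ler_peMl //.
  elim/big_ind: _ => // [x y x1 y1|j _]; last by apply: le_trans (fac j).
  by rewrite -[1]mulr1 ler_pM.
(* Only the factor of index k changes sign between [u k] and [u k.+1]: its values there are -4 and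
   4. *)
have sgP k : (k < d)%N -> P (u k) * P (u k.+1) < 0.
  move=> lt_kd; rewrite /P -big_split (bigD1 (Ordinal lt_kd)) //=.
  rewrite pmulr_llt0; first by rewrite uS /u natz; nia.
  apply: prodr_gt0 => j /eqP jk; have {}jk : (j : nat) <> k by move=> ?; apply/jk/val_inj.
  by rewrite uS /u natz; nia.
have rootk (k : 'I_d) : exists x : R, ((u k)%:~R < x < (u k.+1)%:~R) && root p x.
  have /poly_ivtoo : (u k)%:~R <= (u k.+1)%:~R :> R by rewrite ler_int uS /u; lia.
  case/(_ p); last by move=> x; rewrite inE /= => xI px; exists x; apply/andP.
  rewrite !pE -intrM ltrz0.
  have := sgP k (ltn_ord k); have := absP k; have := absP k.+1; nia.
pose al k := xchoose (rootk k).
have alP (k : 'I_d) : (u k)%:~R < al k < (u k.+1)%:~R /\ root p (al k).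
  by apply/andP/(xchooseP (rootk k)).
exists [seq al k | k <- enum 'I_d].
have al_uniq : uniq [seq al k | k <- enum 'I_d].
  rewrite map_inj_uniq ?enum_uniq // => k j alE; apply/ord_inj/eqP.
  have [/andP[k1 k2] _] := alP k; have [/andP[j1 j2] _] := alP j.
  move: k1 k2; rewrite alE => k1 k2.
  have := lt_trans k1 j2; have := lt_trans j1 k2; rewrite !ltr_int !uS /u; lia.
have alsz : size [seq al k | k <- enum 'I_d] = d by rewrite size_map size_enum_ord.
split => //.
have pmon : p \is monic by rewrite monic_map ?fpoly_monic.
rewrite -/p (@all_roots_prod_XsubC _ p [seq al k | k <- enum 'I_d]).
- by rewrite (monicP pmon) scale1r.
- by rewrite alsz /p size_map_poly_id0 ?size_fpoly // (monicP (fpoly_monic _)) // oner_neq0.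
- by apply/allP => _ /mapP[k _ ->]; case: (alP k).
- by rewrite uniq_rootsE.
Qed.

(** * The quartic form *)

(** The coordinates of index e, ..., e + d - 1 become the coefficients of a polynomial of degree
    below d, that is, an element of S[X]/(f). *)
Definition block (S : nzRingType) (N e d : nat) (v : 'I_N -> S) : {poly S} :=
  \sum_(i < N | (e <= i < e + d)%N) v i *: 'X^(i - e).

Definition quartic_tail (S : nzRingType) (N d : nat) (v : 'I_N -> S) : S :=
  \sum_(i < N | (2 * d <= i)%N) v i ^+ 4.

(* With A and B the two blocks and x_i, y_i their values at the roots of f, this is
   sum_(i <> j) x_i^2 x_j^2 + sum_i y_i^4 + t sum_i x_i^3 y_i plus a Fermat tail. *)
Definition quartic (d : nat) (S : comNzRingType) (N : nat) (t : S) (v : 'I_N -> S) : S :=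
  let A := block 0 d v in let B := block d d v in
  let tr := ptrace (fpoly d) (S := S) in
  tr (A ^+ 2) ^+ 2 - tr (A ^+ 4) + tr (B ^+ 4) + t * tr (A ^+ 3 * B)
    + quartic_tail d v.

Definition tQ : Qt := tofrac ('X : {poly rat}).

Definition quartic_form (d N : nat) : {mpoly Qt[N]} :=
  quartic d (tQ%:MP) (fun i : 'I_N => 'X_i).

Lemma block_map (S S' : nzRingType) (h : {rmorphism S -> S'}) N e d (v : 'I_N -> S) :
  block e d (h \o v) = map_poly h (block e d v).
Proof.
rewrite /block rmorph_sum; apply: eq_bigr => i _.
by rewrite /= map_polyZ map_polyXn.
Qed.

Lemma size_block (S : nzRingType) N e d (v : 'I_N -> S) : (size (block e d v) <= d)%N.
Proof.
apply: (leq_trans (size_sum _ _ _)); apply/bigmax_leqP => i /andP[ei ied].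
by rewrite (leq_trans (size_scale_leq _ _)) // size_polyXn; lia.
Qed.

Lemma coef_block (S : nzRingType) N e d (v : 'I_N -> S) (i : 'I_N) :
  (e <= i < e + d)%N -> (block e d v)`_(i - e) = v i.
Proof.
move=> ei; rewrite coef_sum (bigD1 i) //= coefZ coefXn eqxx mulr1 big1 ?addr0 //.
move=> j /andP[/andP[ej _] ji]; rewrite coefZ coefXn; case: eqP => [|_]; last by rewrite mulr0.
move=> ji'; case/eqP: ji; apply/ord_inj; lia.
Qed.

(** This is why [quartic] is defined over every commutative ring: the same expression serves for the
    form, for its values at points and for its specialisations. *)
Lemma quartic_map (S S' : comNzRingType) (h : {rmorphism S -> S'}) d N t (v : 'I_N -> S) :
  quartic d (h t) (h \o v) = h (quartic d t v).
Proof.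
rewrite /quartic !block_map; set A := block 0 d v; set B := block d d v.
rewrite !(rmorphD, rmorphN, rmorphM, rmorphXn) -!ptrace_map !(rmorphM, rmorphXn) /=.
congr (_ + _).
by rewrite /quartic_tail rmorph_sum; apply: eq_bigr => i _; rewrite rmorphXn.
Qed.

Lemma quartic_ext (S : comNzRingType) d N t (v w : 'I_N -> S) :
  v =1 w -> quartic d t v = quartic d t w.
Proof.
move=> vw; rewrite /quartic /quartic_tail.
have blockE e : block e d v = block e d w by apply: eq_bigr => i _; rewrite vw.
by rewrite !blockE; congr (_ + _); apply: eq_bigr => i _; rewrite vw.
Qed.

Lemma meval_quartic_form (S : comNzRingType) (h : {rmorphism Qt -> S}) d N (v : 'I_N -> S) :
  (map_mpoly h (quartic_form d N)).@[v] = quartic d (h tQ) v.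
Proof.
rewrite /quartic_form -(quartic_map (map_mpoly h)) -(quartic_map (meval v)) /=.
rewrite map_mpolyC mevalC; apply: quartic_ext => i /=.
by rewrite map_mpolyX mevalXU.
Qed.

Lemma dhomog_ptrace (f : {poly int}) (R : nzRingType) N k (g : {poly {mpoly R[N]}}) :
  (forall j, g`_j \is k.-homog) -> ptrace f g \is k.-homog.
Proof.
move=> hg; rewrite /ptrace; apply: rpred_sum => i _; exact: rpredMz.
Qed.

Lemma dhomog_coefM (R : nzRingType) N k l (g h : {poly {mpoly R[N]}}) :
  (forall j, g`_j \is k.-homog) -> (forall j, h`_j \is l.-homog) ->
  forall j, (g * h)`_j \is (k + l).-homog.
Proof.
by move=> hg hh j; rewrite coefM; apply: rpred_sum => i _; apply: dhomogM.
Qed.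

Lemma quartic_homog (R : comNzRingType) d N (t : R) :
  quartic d (t%:MP) (fun i : 'I_N => 'X_i) \is 4.-homog.
Proof.
have hX (i : 'I_N) : ('X_i : {mpoly R[N]}) \is 1.-homog.
  by rewrite dhomogX; apply/eqP; exact: mdeg1.
have hb e : forall j, (block e d (fun i : 'I_N => 'X_i : {mpoly R[N]}))`_j \is 1.-homog.
  move=> j; rewrite coef_sum; apply: rpred_sum => i _; rewrite coefZ coefXn.
  by case: (j == _); [rewrite mulr1; exact: hX | rewrite mulr0; exact: rpred0].
rewrite /quartic; set A := block 0 _ _; set B := block d _ _.
have h2 e f := dhomog_coefM (hb e) (hb f).
have h3 e f g := dhomog_coefM (h2 e f) (hb g).
have h4 e f g h := dhomog_coefM (h3 e f g) (hb h).
apply: rpredD; last first.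
  apply: rpred_sum => i _; exact: (dhomogMn 4 (hX i)).
apply: rpredD; last first.
  rewrite mul_mpolyC; apply: rpredZ; apply: dhomog_ptrace.
  rewrite !exprS expr0 mulr1 !mulrA; exact: h4.
apply: rpredD; last first.
  by apply: dhomog_ptrace; rewrite !exprS expr0 mulr1 !mulrA; exact: h4.
apply: rpredB; last first.
  by apply: dhomog_ptrace; rewrite !exprS expr0 mulr1 !mulrA; exact: h4.
exact: (dhomogMn 2 (dhomog_ptrace _ (h2 _ _))).
Qed.

Lemma quartic_form_homog d N : quartic_form d N \is 4.-homog.
Proof. exact: quartic_homog. Qed.

Lemma block_eq0 (S : nzRingType) N e d (v : 'I_N -> S) :
  (forall i : 'I_N, (e <= i < e + d)%N -> v i = 0) -> block e d v = 0.
Proof. by move=> v0; rewrite /block big1 // => i /v0 ->; rewrite scale0r. Qed.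

(** For 2 d < N the Fermat tail is nonempty; at the unit vector of index 2 d the form takes the
    value 1. *)
Lemma quartic_form_neq0 d N : (2 * d < N)%N -> quartic_form d N != 0.
Proof.
move=> dN; apply/eqP => H0.
pose i0 := Ordinal dN; pose v (i : 'I_N) : Qt := (i == i0)%:R.
have := meval_quartic_form (idfun : Qt -> Qt) d v.
rewrite H0 raddf0 meval0 /quartic !block_eq0; first last.
- by move=> i ?; rewrite /v; case: eqP => // iE; move: (congr1 val iE) => /=; lia.
- by move=> i ?; rewrite /v; case: eqP => // iE; move: (congr1 val iE) => /=; lia.
rewrite mulr0 !expr0n !ptrace0 expr0n !mulr0 subrr !add0r => /esym/eqP.
rewrite /quartic_tail (bigD1 i0) //= big1 => [|i /andP[_ /negPf ii0]]; last first.
  by rewrite /v ii0 expr0n.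
by rewrite /v eqxx expr1n addr0 oner_eq0.
Qed.

(** The point is A = q = f/(X - a), B = 0, up to scaling the idempotent of L[X]/(f) belonging to a.
    Here Tr(q^2)^2 and Tr(q^4) both equal q(a)^4 and cancel. *)
Lemma root_fpoly_has_point d N (L : fieldExtType Qt) (a : L) : (0 < d)%N -> (d <= N)%N ->
  root (map_poly intr (fpoly d)) a -> has_point L (quartic_form d N).
Proof.
move=> d_gt0 dN /factor_theorem[q qE].
have fmon := map_intr_monic L (fpoly_monic d_gt0).
have qmon : q \is monic by move: fmon; rewrite qE monicMr ?monicXsubC.
have szq : size q = d.
  have := size_fpoly d_gt0.
  rewrite -(size_map_poly_id0 (f := intr : int -> L)) => [|]; last first.
    by rewrite (monicP (fpoly_monic d_gt0)) oner_neq0.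
  by rewrite qE size_Mmonic ?monicXsubC ?monic_neq0 // size_XsubC addn2 => -[].
pose v (i : 'I_N) : L := q`_i; exists v; split.
  have dN' : (d.-1 < N)%N by lia.
  exists (Ordinal dN'); rewrite /v /= -szq -lead_coefE (monicP qmon).
  exact: oner_neq0.
have vd (i : 'I_N) : (d <= i)%N -> v i = 0 by move=> di; rewrite /v nth_default ?szq.
rewrite meval_quartic_form /quartic (@block_eq0 _ _ d); last by move=> i /andP[/vd].
have -> : block 0 d v = q.
  apply/polyP => j; case: (ltnP j d) => jd; last first.
    by rewrite !nth_default // ?szq // (leq_trans (size_block _ _ _)).
  have jN : (j < N)%N by lia.
  by have := @coef_block _ _ 0 d v (Ordinal jN); rewrite /= subn0 => ->.
rewrite mulr0 expr0n !ptrace0 mulr0 !addr0 /quartic_tail big1 => [|i ?]; last first.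
  by rewrite vd ?expr0n //; lia.
have tr := ptrace_root_quotient _ (fpoly_monic d_gt0) qE.
rewrite [q ^+ 2]expr2 tr [q ^+ 4]exprSr tr !hornerE; ring.
Qed.

(** * Partial derivatives of the quartic *)

Definition coef_mderiv (R : nzRingType) (N : nat) (i : 'I_N) (g : {poly {mpoly R[N]}}) :=
  map_poly (mderiv i) g.

Lemma coef_mderivE (R : nzRingType) N (i : 'I_N) (g : {poly {mpoly R[N]}}) j :
  (coef_mderiv i g)`_j = (g`_j)^`M(i).
Proof. by rewrite coef_map_id0 // mderiv0. Qed.

Lemma coef_mderivM (R : comNzRingType) N (i : 'I_N) (g h : {poly {mpoly R[N]}}) :
  coef_mderiv i (g * h) = coef_mderiv i g * h + g * coef_mderiv i h.
Proof.
apply/polyP => j; rewrite coef_mderivE coefD !coefM raddf_sum -big_split.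
by apply: eq_bigr => k _; rewrite /= mderivM !coef_mderivE.
Qed.

Lemma mderiv_ptrace (f : {poly int}) (R : nzRingType) N (i : 'I_N)
    (g : {poly {mpoly R[N]}}) :
  (ptrace f g)^`M(i) = ptrace f (coef_mderiv i g).
Proof.
rewrite (@ptrace_widen _ _ (coef_mderiv i g) (size g)) ?size_poly //.
rewrite /ptrace raddf_sum; apply: eq_bigr => k _.
by rewrite /= raddfMz coef_mderivE.
Qed.

Lemma mderivXU (R : nzRingType) N (i k : 'I_N) :
  ('X_k : {mpoly R[N]})^`M(i) = (k == i)%:R.
Proof.
rewrite mderivX mnmE; case: eqP => [->|_]; last by rewrite scale0r.
rewrite scale1r (_ : (U_(i) - U_(i))%MM = 0%MM) ?mpolyX0 //.
by apply/mnmP => l; rewrite !mnmE subnn.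
Qed.

Lemma coef_mderiv_block (R : nzRingType) N (i : 'I_N) e d :
  coef_mderiv i (block e d (fun k : 'I_N => 'X_k : {mpoly R[N]})) =
  if (e <= i < e + d)%N then 'X^(i - e) else 0.
Proof.
apply/polyP => j; rewrite coef_mderivE coef_sum raddf_sum /=.
have E (k : 'I_N) : (('X_k *: 'X^(k - e) : {poly {mpoly R[N]}})`_j)^`M(i)
    = (k == i)%:R * (j == k - e)%N%:R.
  by rewrite coefZ coefXn; case: (j == _); rewrite ?mulr1 ?mulr0 ?mderiv0 ?mderivXU.
under eq_bigr => k _ do rewrite E.
case: ifP => ei; last first.
  rewrite coef0 big1 // => k ke; case: eqP => [ki|_]; last by rewrite mul0r.
  by move: ke; rewrite ki ei.
rewrite (bigD1 i) //= eqxx mul1r big1 ?addr0 ?coefXn // => k /andP[_ /negPf ->].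
by rewrite mul0r.
Qed.

Lemma mderiv_quartic_tail (R : comNzRingType) N (i : 'I_N) d :
  (quartic_tail d (fun k : 'I_N => 'X_k : {mpoly R[N]}))^`M(i) =
  if (2 * d <= i)%N then 4%:R * 'X_i ^+ 3 else 0.
Proof.
have dX4 (k : 'I_N) : ('X_k ^+ 4 : {mpoly R[N]})^`M(i) = (k == i)%:R * (4%:R * 'X_k ^+ 3).
  have -> : 'X_k ^+ 4 = 'X_k * 'X_k * ('X_k * 'X_k) :> {mpoly R[N]} by ring.
  by rewrite !mderivM !mderivXU; ring.
rewrite /quartic_tail raddf_sum /=.
under eq_bigr => k _ do rewrite dX4.
case: ifP => di; last first.
  by rewrite big1 // => k dk; case: eqP => [ki|_]; [move: dk; rewrite ki di | rewrite mul0r].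
rewrite (bigD1 i) //= eqxx mul1r big1 ?addr0 // => k /andP[_ /negPf ->].
by rewrite mul0r.
Qed.

(** Within each block, the partial derivative in the coefficient of X^j is the trace of X^j times a
    polynomial independent of j. At a singular point this polynomial is therefore orthogonal, for
    the trace form, to all X^j with j < d. *)
Lemma mderiv_quartic (R : comNzRingType) d N (t : R) (i : 'I_N) :
  let X (k : 'I_N) : {mpoly R[N]} := 'X_k in
  let A := block 0 d X in let B := block d d X in
  let S := ptrace (fpoly d) (A ^+ 2) in
  (quartic d t%:MP X)^`M(i) =
  ptrace (fpoly d)
    (coef_mderiv i A * (4%:R * S%:P * A - 4%:R * A ^+ 3 + 3%:R * t%:MP%:P * A ^+ 2 * B)
     + coef_mderiv i B * (4%:R * B ^+ 3 + t%:MP%:P * A ^+ 3))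
  + (if (2 * d <= i)%N then 4%:R * 'X_i ^+ 3 else 0).
Proof.
move=> X A B S.
pose D (g : {poly {mpoly R[N]}}) := coef_mderiv i g.
have D2 g : D (g ^+ 2) = 2%:R * g * D g.
  by rewrite expr2 /D coef_mderivM; ring.
have D3 g : D (g ^+ 3) = 3%:R * g ^+ 2 * D g.
  by rewrite exprS [D _]coef_mderivM -/(D g) -/(D (g ^+ 2)) D2; ring.
have D4 g : D (g ^+ 4) = 4%:R * g ^+ 3 * D g.
  by rewrite exprS [D _]coef_mderivM -/(D g) -/(D (g ^+ 3)) D3; ring.
have DAB : D (A ^+ 3 * B) = 3%:R * A ^+ 2 * D A * B + A ^+ 3 * D B.
  by rewrite [D _]coef_mderivM -/(D _) D3.
rewrite /quartic -/A -/B -/S !mderivD mderivN mderiv_quartic_tail; congr (_ + _).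
rewrite expr2 !mderivM mderivC mul0r add0r !mderiv_ptrace -!/(D _) D2 !D4 DAB.
rewrite -[- ptrace _ _]mulN1r [ptrace _ _ * S]mulrC -!ptraceZ -!ptraceD.
by congr ptrace; rewrite -!mul_polyC rmorphN1; ring.
Qed.

(** * Smoothness *)

Lemma algebraic_sum (F E : fieldType) (iota : {rmorphism F -> E}) (I : Type)
    (r : seq I) (u : I -> E) :
  (forall i, algebraicOver iota (u i)) -> algebraicOver iota (\sum_(i <- r) u i).
Proof.
move=> alg_u; elim/big_rec: _ => [|i x _ alg_x]; first exact: algebraic0.
exact: algebraic_add.
Qed.

(** Over a field, algebraic and integral mean the same, and an element integral over integral ones
    is integral. *)
Lemma algebraic_root_monic (F E : fieldType) (iota : {rmorphism F -> E}) (p : {poly E}) u :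
  p \is monic -> root p u -> (forall i, algebraicOver iota p`_i) -> algebraicOver iota u.
Proof.
move=> pmon pu0 alg_p; apply/integral_algebraic.
apply: integral_root_monic pmon pu0 _ => _ /(nthP 0)[i _ <-].
exact/integral_algebraic.
Qed.

Lemma algebraic_expr_root (F E : fieldType) (iota : {rmorphism F -> E}) (n : nat) (u : E) :
  algebraicOver iota (u ^+ n.+1) -> algebraicOver iota u.
Proof.
move=> alg_u; refine (@algebraic_root_monic _ _ iota ('X^(n.+1) - (u ^+ n.+1)%:P) _ _ _ _).
- rewrite monicE lead_coefDl ?lead_coefXn // size_polyN size_polyXn.
  by rewrite (leq_ltn_trans (size_polyC_leq1 _)).
- by rewrite /root hornerD hornerN hornerC hornerXn subrr.
move=> i; rewrite coefB coefXn coefC; apply: algebraic_sub.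
  by case: eqP => _; [exact: algebraic1 | exact: algebraic0].
by case: eqP => _; [|exact: algebraic0].
Qed.

Lemma algebraic_nat (F E : fieldType) (iota : {rmorphism F -> E}) n :
  algebraicOver iota n%:R.
Proof. by rewrite -(rmorph_nat iota); apply: algebraic_id. Qed.

(* Put w_i = -3 t y_i / (4 x_i), so that w_i^3 = tau := 27 t^4 / 256 and x_i^2 (1 + w_i) = S.
   Since (1 + w)(1 - w + w^2) = 1 + w^3, summing over the support of x gives
   sum_i (1 - w_i + w_i^2) = 1 + tau.  All w_i are cube roots of unity times a fixed w, so this
   is a monic cubic equation for w with algebraic coefficients, whence t is algebraic. *)
Lemma critical_system_trivial (F E : fieldType) (iota : {rmorphism F -> E}) (t : E)
    (I : eqType) (r : seq I) (x y : I -> E) :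
  [pchar E] =i pred0 -> ~ algebraicOver iota t ->
  let S := \sum_(i <- r) x i ^+ 2 in
  (forall i, i \in r -> 4%:R * S * x i - 4%:R * x i ^+ 3 + 3%:R * t * x i ^+ 2 * y i = 0) ->
  (forall i, i \in r -> 4%:R * y i ^+ 3 + t * x i ^+ 3 = 0) ->
  forall i, i \in r -> x i = 0 /\ y i = 0.
Proof.
move=> /pcharf0P E0 t_tr S eqx eqy.
have n0 n : n.+1%:R != 0 :> E by rewrite E0.
have y0 i : i \in r -> x i = 0 -> y i = 0.
  move=> ir xi0; have := eqy i ir; rewrite xi0 expr0n mulr0 addr0 => /eqP.
  by rewrite mulf_eq0 (negPf (n0 3)) expf_eq0 /= => /eqP.
suff x0 i : i \in r -> x i = 0 by move=> i ir; split; [exact: x0 | apply: y0 (x0 i ir)].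
move=> i0r; apply/eqP/negP => /negP xi0; set i0 := i in i0r xi0.
pose tau := 27%:R / 256%:R * t ^+ 4.
have tau_tr : ~ algebraicOver iota tau.
  move=> alg; apply: t_tr; apply: (@algebraic_expr_root _ _ iota 3).
  have -> : t ^+ 4 = tau / (27%:R / 256%:R).
    by rewrite /tau mulrC mulKf // mulf_neq0 ?invr_eq0 ?n0.
  by do ?apply: algebraic_div => //; apply: algebraic_nat.
pose w j := - (3%:R * t * y j / (4%:R * x j)).
have w3 j : j \in r -> x j != 0 -> w j ^+ 3 = tau.
  move=> jr xj0; have /eqP := eqy j jr; rewrite addr_eq0 => /eqP yE.
  have -> : w j ^+ 3 = - (27%:R * t ^+ 3 * (4%:R * y j ^+ 3)) / (256%:R * x j ^+ 3).
    by rewrite /w; field; rewrite xj0 !n0.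
  by rewrite yE /tau; field; rewrite xj0 n0.
have wS j : j \in r -> x j != 0 -> x j ^+ 2 * (1 + w j) = S.
  move=> jr xj0; have := eqx j jr => e.
  have : 4%:R * x j * (x j ^+ 2 * (1 + w j) - S) = 0.
    by rewrite -[RHS]oppr0 -e /w; field; rewrite xj0 n0.
  by move/eqP; rewrite !mulf_eq0 (negPf (n0 3)) (negPf xj0) /= subr_eq0 => /eqP.
have tauN1 : 1 + tau != 0.
  apply/eqP => e; apply: tau_tr; have -> : tau = - 1 by apply/eqP; rewrite -addr_eq0 addrC e.
  exact/algebraic_opp/algebraic1.
have wN1 j : j \in r -> x j != 0 -> 1 + w j != 0.
  move=> jr xj0; apply: contraNneq tauN1 => w1.
  rewrite -(w3 j jr xj0) (_ : 1 + w j ^+ 3 = (1 + w j) * (1 - w j + w j ^+ 2)); last by ring.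
  by rewrite w1 mul0r.
have S0 : S != 0 by rewrite -(wS i0) // mulf_neq0 ?expf_neq0 ?wN1.
pose r' := [seq j <- r | x j != 0].
(* After multiplication by S = x_j^2 (1 + w_j), each summand on the left becomes x_j^2 (1 + tau),
   and the x_j^2 add up to S. *)
have sumw : \sum_(j <- r') (1 - w j + w j ^+ 2) = 1 + tau.
  apply: (mulfI S0); rewrite mulr_sumr {2}/S mulr_suml [RHS](bigID (fun j => x j == 0)) /=.
  rewrite [X in _ = X + _]big1 ?add0r => [|j /eqP ->]; last by rewrite expr0n mul0r.
  rewrite /r' big_filter big_seq_cond [RHS]big_seq_cond.
  apply: eq_bigr => j /andP[jr xj0]; rewrite -(wS j jr xj0) -(w3 j jr xj0); ring.
pose z := w i0.
have z3 : z ^+ 3 = tau by exact: w3.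
have z0 : z != 0.
  apply/eqP => z0; apply: tau_tr; rewrite -z3 z0 expr0n; exact: algebraic0.
(* On the support of x this is a cube root of unity; the default 0 elsewhere makes it algebraic for
   every index, as [algebraic_sum] requires. *)
pose om j := if (j \in r) && (x j != 0) then w j / z else 0.
have om_alg j : algebraicOver iota (om j).
  rewrite /om; case: ifP => [/andP[jr xj0]|_]; last exact: algebraic0.
  apply: (@algebraic_expr_root _ _ iota 2); rewrite expr_div_n z3 w3 // divff.
    exact: algebraic1.
  by apply/eqP => tau0; apply: tau_tr; rewrite tau0; exact: algebraic0.
pose e1 := \sum_(j <- r') om j; pose e2 := \sum_(j <- r') om j ^+ 2.
(* With w_j = om_j z and tau = z^3, the identity [sumw] reads n - e1 z + e2 z^2 = 1 + z^3, where n
   is the size of r'. *)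
pose p : {poly E} := 'X^3 + (- e2 *: 'X^2 + (e1 *: 'X + (1 - (size r')%:R)%:P)).
have p_root : root p z.
  have e : \sum_(j <- r') (1 - om j * z + om j ^+ 2 * z ^+ 2) = 1 + tau.
    rewrite -sumw; apply: eq_big_seq => j; rewrite mem_filter => /andP[xj0 jr].
    by rewrite /om jr xj0 /= -exprMn divfK.
  rewrite /root /p !(hornerD, hornerZ, hornerC, hornerX, hornerXn) z3; apply/eqP.
  move: e; rewrite big_split sumrB -!mulr_suml -/e1 -/e2 big_const_seq count_predT iter_addr_0.
  move=> e; have -> : tau = (size r')%:R - e1 * z + e2 * z ^+ 2 - 1 by rewrite e; ring.
  ring.
have p_alg k : algebraicOver iota p`_k.
  have an := algebraic_nat iota.
  rewrite /p !coefD !coefZ coefXn coefXn coefX coefC.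
  have a1 : algebraicOver iota e1 by apply: algebraic_sum.
  have a2 : algebraicOver iota e2.
    by apply: algebraic_sum => j; rewrite expr2; apply: algebraic_mul.
  apply: algebraic_add; first exact: an.
  apply: algebraic_add; first by apply: algebraic_mul; [exact: algebraic_opp | exact: an].
  apply: algebraic_add; first by apply: algebraic_mul; [|exact: an].
  case: eqP => _; last exact: algebraic0.
  by apply: algebraic_sub; [exact: algebraic1 | exact: an].
have p_mon : p \is monic.
  rewrite monicE /p lead_coefDl ?lead_coefXn // size_polyXn.
  have s2 : (size (- e2 *: 'X^2 + (e1 *: 'X + (1 - (size r')%:R)%:P) : {poly E})%R <= 3)%N.
    rewrite (leq_trans (size_polyD _ _)) // geq_max (leq_trans (size_scale_leq _ _)) ?size_polyXn //=.
    rewrite (leq_trans (size_polyD _ _)) // geq_max (leq_trans (size_scale_leq _ _)) ?size_polyX //=.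
    by rewrite (leq_trans (size_polyC_leq1 _)).
  by rewrite (leq_ltn_trans s2).
apply: tau_tr; rewrite -z3 exprS expr2.
have za := algebraic_root_monic p_mon p_root p_alg.
by do ?apply: algebraic_mul.
Qed.

Definition Qt_const : {rmorphism rat -> Qt} := (@tofrac {poly rat} \o polyC).

(** Evaluating p at t returns the image of p itself under injective maps, so p(t) = 0 forces p =
    0. *)
Lemma tQ_transcendental (E : fieldType) (h : {rmorphism Qt -> E}) :
  ~ algebraicOver (h \o Qt_const) (h tQ).
Proof.
case=> p p0; rewrite map_poly_comp /root horner_map fmorph_eq0 /Qt_const /tQ.
rewrite map_poly_comp horner_map tofrac_eq0 -/(p \Po 'X) comp_polyXr.
by rewrite (negPf p0).
Qed.

Lemma pchar_Qt_ext (E : fieldType) (h : {rmorphism Qt -> E}) : [pchar E] =i pred0.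
Proof. by move=> p; rewrite (fmorph_pchar (h \o Qt_const)) pchar_num. Qed.

(** The roots are distinct because f is irreducible over Q and f' is nonzero of smaller degree, so f
    and f' are coprime. *)
Lemma fpoly_splits d (C : closedFieldType) (k : {rmorphism rat -> C}) : (0 < d)%N ->
  exists r : seq C, [/\ uniq r, size r = d &
    map_poly intr (fpoly d) = \prod_(a <- r) ('X - a%:P)].
Proof.
move=> d_gt0; have fmon := fpoly_monic d_gt0.
have [r rE] := closed_field_poly_normal (map_poly intr (fpoly d) : {poly C}).
rewrite (monicP (map_intr_monic C fmon)) scale1r in rE.
exists r; split => //; last first.
  have := size_fpoly d_gt0; rewrite -(size_map_poly_id0 (f := intr : int -> C)).
    by rewrite rE size_prod_XsubC => -[].
  by rewrite (monicP fmon) oner_neq0.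
rewrite -separable_prod_XsubC -rE.
have -> : map_poly intr (fpoly d) = map_poly k (map_poly intr (fpoly d)) :> {poly C}.
  by rewrite -map_poly_comp; apply: eq_map_poly => x; rewrite /= rmorph_int.
rewrite separable_map unlock irreducible_poly_coprime; last exact: fpoly_irreducible.
have szQ : size (map_poly intr (fpoly d) : {poly rat}) = d.+1.
  by rewrite size_map_poly_id0 ?size_fpoly // (monicP fmon) oner_neq0.
set fQ := map_poly intr _ in szQ *.
have fQmon : fQ \is monic by exact: map_intr_monic.
have d'0 : fQ^`() != 0.
  apply/eqP => /(congr1 (fun g : {poly rat} => g`_d.-1)); rewrite coef_deriv coef0 prednK //.
  have -> : fQ`_d = 1 by have := monicP fQmon; rewrite lead_coefE szQ.
  by move/eqP; rewrite pnatr_eq0 -[d == _]negbK -lt0n d_gt0.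
apply/negP => /(dvdp_leq d'0); rewrite leqNgt lt_size_deriv //.
exact: monic_neq0.
Qed.

(** The hypothesis extends by linearity to sum_a P(a) g(a) = 0 for every P with deg P < |r|. Taking
    P to be the product of X - b over the nodes b other than a isolates g(a). *)
Lemma vandermonde_eq0 (F : fieldType) (r : seq F) (g : F -> F) : uniq r ->
  (forall j, (j < size r)%N -> \sum_(a <- r) a ^+ j * g a = 0) ->
  forall a, a \in r -> g a = 0.
Proof.
move=> r_uniq g0.
have gP (P : {poly F}) : (size P <= size r)%N -> \sum_(a <- r) P.[a] * g a = 0.
  move=> szP; under eq_bigr => a _ do rewrite (horner_coef_wide _ szP) mulr_suml.
  rewrite exchange_big big1 // => j _.
  by under eq_bigr => a _ do rewrite -mulrA; rewrite -mulr_sumr g0 ?mulr0.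
move=> a ar; pose P := \prod_(b <- rem a r) ('X - b%:P).
have szP : (size P <= size r)%N.
  by rewrite size_prod_XsubC size_rem // prednK // -has_predT; apply/hasP; exists a.
have := gP P szP; rewrite (bigD1_seq a) //= big1_seq => [|b /andP[ba br]]; last first.
  rewrite (_ : P.[b] = 0) ?mul0r //; apply/rootP.
  by rewrite root_prod_XsubC mem_rem_uniq // inE ba.
rewrite addr0 => /eqP; rewrite mulf_eq0 => /orP[|/eqP //].
by rewrite -/(root P a) root_prod_XsubC mem_rem_uniq // inE eqxx.
Qed.

Lemma size_le_roots_eq0 (F : fieldType) (r : seq F) (p : {poly F}) : uniq r ->
  (size p <= size r)%N -> (forall a, a \in r -> p.[a] = 0) -> p = 0.
Proof.
move=> r_uniq szp p0; apply: (@roots_geq_poly_eq0 _ p r) => //.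
by apply/allP => a /p0; rewrite /root => ->.
Qed.

Lemma rmorph_gradient (S S' : comNzRingType) (M : {rmorphism S -> S'}) a b s t a' b' :
  M (a' * (4%:R * s * a - 4%:R * a ^+ 3 + 3%:R * t * a ^+ 2 * b)
     + b' * (4%:R * b ^+ 3 + t * a ^+ 3)) =
  M a' * (4%:R * M s * M a - 4%:R * M a ^+ 3 + 3%:R * M t * M a ^+ 2 * M b)
     + M b' * (4%:R * M b ^+ 3 + M t * M a ^+ 3).
Proof. by rewrite !(rmorph_nat, rmorphXn, rmorphN, rmorphM, rmorphD). Qed.

Lemma meval_mderiv_quartic (R S : comNzRingType) (h : {rmorphism R -> S}) d N (t : R)
    (v : 'I_N -> S) (i : 'I_N) :
  let A := block 0 d v in let B := block d d v in
  let T := ptrace (fpoly d) (A ^+ 2) in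
  (map_mpoly h (quartic d t%:MP (fun k : 'I_N => 'X_k))^`M(i)).@[v] =
  ptrace (fpoly d)
    ((if (0 <= i < 0 + d)%N then 'X^(i - 0) else 0) *
       (4%:R * T%:P * A - 4%:R * A ^+ 3 + 3%:R * (h t)%:P * A ^+ 2 * B)
     + (if (d <= i < d + d)%N then 'X^(i - d) else 0) * (4%:R * B ^+ 3 + (h t)%:P * A ^+ 3))
  + (if (2 * d <= i)%N then 4%:R * v i ^+ 3 else 0).
Proof.
move=> A B T; pose phi : {rmorphism {mpoly R[N]} -> S} := (meval v \o map_mpoly h).
rewrite -[LHS]/(phi _) mderiv_quartic.
pose X (k : 'I_N) : {mpoly R[N]} := 'X_k; rewrite -/X.
have phiX k : phi (X k) = v k by rewrite /phi /X /= map_mpolyX mevalXU.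
have phit : phi t%:MP = h t by rewrite /phi /= map_mpolyC mevalC.
pose M : {rmorphism {poly {mpoly R[N]}} -> {poly S}} := map_poly phi.
have Mb e : M (block e d X) = block e d v.
  by rewrite /M /= -block_map; apply: eq_bigr => k _; congr (_ *: _); exact: phiX.
have MC c : M c%:P = (phi c)%:P by exact: map_polyC.
have Mtr g : phi (ptrace (fpoly d) g) = ptrace (fpoly d) (M g) by exact: esym (ptrace_map _ _ _).
have Mif (b : bool) n : M (if b then 'X^n else 0) = if b then 'X^n else 0.
  by case: b; [exact: map_polyXn | exact: rmorph0].
rewrite rmorphD Mtr !coef_mderiv_block rmorph_gradient !Mif !MC !Mb Mtr rmorphXn Mb phit.
congr (_ + _); case: ifP => _; last exact: rmorph0.
by rewrite rmorphM rmorphXn rmorph_nat phiX.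
Qed.

(** If all partial derivatives vanish at v, the Vandermonde argument turns the first 2 d of them
    into the system of [critical_system_trivial] at the roots of f. So A and B vanish at d distinct
    points and have degree below d, whence A = B = 0; the remaining coordinates satisfy 4 v_i^3 =
    0. *)
Lemma quartic_form_smooth d N : (0 < d)%N -> (2 * d < N)%N ->
  smooth_hypersurface 4 (quartic_form d N).
Proof.
move=> d_gt0 dN; split; [exact: quartic_form_neq0 | exact: quartic_form_homog |].
move=> C h v [[i0 vi0] _].
case: (pickP (fun i => (map_mpoly h (quartic_form d N)^`M(i)).@[v] != 0)) => [i di|no_d].
  by exists i.
have {}no_d i : (map_mpoly h (quartic_form d N)^`M(i)).@[v] = 0.
  by apply/eqP/negbFE/no_d.
case/negP: vi0; apply/eqP.
have [r [r_uniq szr fE]] := fpoly_splits (h \o Qt_const) d_gt0.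
pose A := block 0 d v; pose B := block d d v.
have tr (g : {poly C}) : ptrace (fpoly d) g = \sum_(a <- r) g.[a].
  by apply: ptrace_roots fE => //; [rewrite szr | exact: fpoly_monic].
pose S := \sum_(a <- r) A.[a] ^+ 2.
have SE : ptrace (fpoly d) (A ^+ 2) = S.
  by rewrite tr; apply: eq_bigr => a _; rewrite horner_exp.
pose GA := 4%:R * S%:P * A - 4%:R * A ^+ 3 + 3%:R * (h tQ)%:P * A ^+ 2 * B.
pose GB := 4%:R * B ^+ 3 + (h tQ)%:P * A ^+ 3.
have dE (i : 'I_N) :
    ptrace (fpoly d) ((if (0 <= i < 0 + d)%N then 'X^(i - 0) else 0) * GA
      + (if (d <= i < d + d)%N then 'X^(i - d) else 0) * GB)
    + (if (2 * d <= i)%N then 4%:R * v i ^+ 3 else 0) = 0.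
  by rewrite -[RHS](no_d i) meval_mderiv_quartic -/A -/B SE.
have GA0 a : a \in r -> GA.[a] = 0.
  apply: (vandermonde_eq0 (g := fun a => GA.[a])) => // j; rewrite szr => jd.
  have jN : (j < N)%N by lia.
  have := dE (Ordinal jN); rewrite /= jd subn0 ifF; last by lia.
  rewrite ifF; last by lia.
  rewrite mul0r !addr0 tr => e; rewrite -[RHS]e.
  by apply: eq_bigr => b _; rewrite hornerM hornerXn.
have GB0 a : a \in r -> GB.[a] = 0.
  apply: (vandermonde_eq0 (g := fun a => GB.[a])) => // j; rewrite szr => jd.
  have jN : (d + j < N)%N by lia.
  have := dE (Ordinal jN); rewrite /= ifF; last by lia.
  rewrite ifT; last by lia.
  rewrite ifF; last by lia.
  rewrite mul0r add0r addr0 addKn tr => e; rewrite -[RHS]e.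
  by apply: eq_bigr => b _; rewrite hornerM hornerXn.
have AB0 : forall a, a \in r -> A.[a] = 0 /\ B.[a] = 0.
  apply: (critical_system_trivial (pchar_Qt_ext h) (@tQ_transcendental _ h)) => a ar.
    by rewrite -[RHS](GA0 a ar) /GA -!polyC_natr !(hornerD, hornerN, hornerM, horner_exp, hornerC).
  by rewrite -[RHS](GB0 a ar) /GB -!polyC_natr !(hornerD, hornerN, hornerM, horner_exp, hornerC).
have A0 : A = 0.
  by apply: (size_le_roots_eq0 r_uniq) => [|a /AB0[]//]; rewrite szr size_block.
have B0 : B = 0.
  by apply: (size_le_roots_eq0 r_uniq) => [|a /AB0[]//]; rewrite szr size_block.
have [i0d|di0] := ltnP i0 d.
  by rewrite -(@coef_block _ _ 0 d v i0) // -/A A0 coef0.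
have [i0d|d2i0] := ltnP i0 (d + d).
  by rewrite -(@coef_block _ _ d d v i0) ?di0 // -/B B0 coef0.
have := dE i0; rewrite ifF; last by lia.
rewrite ifF; last by lia.
rewrite ifT; last by lia.
rewrite !mul0r addr0 ptrace0 add0r => /eqP.
have /pcharf0P C0 := pchar_Qt_ext h.
by rewrite mulf_eq0 C0 expf_eq0 /= => /eqP.
Qed.

(** * Real specialisation of odd extensions *)

Lemma fraction_repr (D : idomainType) (x : {fraction D}) :
  exists p q, q != 0 /\ tofrac q * x = tofrac p.
Proof.
elim/quotW: x => u; exists u.1, u.2; split; first exact: denom_ratioP.
rewrite /tofrac; unlock FracField.tofrac.
rewrite -[LHS]FracField.pi_mul; apply/eqmodP.
rewrite /= FracField.equivfE /FracField.mulf !numden_Ratio ?oner_neq0 ?mulf_neq0 ?denom_ratioP //.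
by rewrite mul1r mulr1.
all: exact: oner_neq0.
Qed.

Lemma tofrac_inj (D : idomainType) : injective (@tofrac D).
Proof. by move=> x y /eqP; rewrite tofrac_eq => /eqP. Qed.

Lemma map_tofrac_inj (D : idomainType) : injective (map_poly (@tofrac D)).
Proof. by apply: map_inj_poly; [exact: tofrac_inj | exact: rmorph0]. Qed.

Lemma clear_denominators (D : idomainType) (u : {poly {fraction D}}) :
  exists q U, q != 0 /\ tofrac q *: u = map_poly (@tofrac D) U.
Proof.
elim/poly_ind: u => [|u c [q1 [U1 [q1_neq0 u1E]]]].
  by exists 1, 0; rewrite oner_neq0 scaler0 rmorph0.
have [p [q [q_neq0 cE]]] := fraction_repr c.
exists (q1 * q), ((q *: U1) * 'X + (q1 * p)%:P); split; first exact: mulf_neq0.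
rewrite rmorphD /= [map_poly _ (_ * 'X)]rmorphM /= map_polyX map_polyC map_polyZ /= -u1E !rmorphM /= -cE.
rewrite scalerDr -!scalerAl scalerA [tofrac q * tofrac q1]mulrC; congr (_ + _).
by rewrite -mul_polyC !polyCM mulrA.
Qed.

Section Specialization.

Variables (D : idomainType) (L : fieldExtType {fraction D}).

Definition frac_alg : {rmorphism D -> L} := (in_alg L \o @tofrac D).

(** One polynomial P over D is evaluated in two ways: at a generator theta of L, and at a real
    number after specialising D. *)
Definition eval2 (S : comNzRingType) (e : {rmorphism D -> S}) (x : S) :
  {rmorphism {poly D} -> S} := (horner_eval x \o map_poly e).

Lemma eval2C (S : comNzRingType) (e : {rmorphism D -> S}) (x : S) c :
  eval2 e x c%:P = e c.
Proof. by rewrite /eval2 /= map_polyC /horner_eval hornerC. Qed.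

Lemma eval2E (S : comNzRingType) (e : {rmorphism D -> S}) (x : S) P :
  eval2 e x P = (map_poly e P).[x].
Proof. by []. Qed.

(* rho e is a real root of the minimal polynomial of theta specialised along e: it exists because
   the degree is odd. *)
Lemma real_specialization (R : rcfType) : [pchar L] =i pred0 -> odd (\dim {: L}) ->
  exists theta : L,
    (forall x : L, exists q P, q != 0 /\ frac_alg q * x = eval2 frac_alg theta P) /\
    exists rho : {rmorphism D -> R} -> R, forall P : {poly D},
      exists2 b : D, b != 0 & forall e : {rmorphism D -> R}, e b != 0 ->
        (eval2 e (rho e) P == 0) = (eval2 frac_alg theta P == 0).
Proof.
move=> char0 odd_L.
have [theta theta_gen] : exists theta : L, <<1; theta>>%VS = {: L}%VS.
  have sep : separable 1 {: L} by apply/separableP => u _; exact: pcharf0_separable.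
  by exists (separable_generator 1 {:L}); rewrite -eq_adjoin_separable_generator ?sub1v.
have repr (x : L) : exists q P, q != 0 /\ frac_alg q * x = eval2 frac_alg theta P.
  have /Fadjoin_polyP[p /polyOver1P[u ->] ->] : x \in <<1; theta>>%VS by rewrite theta_gen memvf.
  have [q [U [q0 uE]]] := clear_denominators u; exists q, U; split=> //.
  by rewrite eval2E /frac_alg map_poly_comp -uE map_polyZ hornerZ.
exists theta; split => //.
have /polyOver1P[m mE] := minPolyOver 1 theta.
have szm : size m = (\dim {: L}).+1.
  rewrite -(size_map_poly (in_alg L)) -mE size_minPoly -theta_gen dim_Fadjoin dimv1 muln1 //.
have [q0 [F [q0_neq0 FE]]] := clear_denominators m.
have szF : size F = (\dim {: L}).+1.
  rewrite -szm -(size_scale m (a := tofrac q0)) ?tofrac_eq0 // FE size_map_inj_poly ?rmorph0 //.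
  exact: tofrac_inj.
(* The default 0 is taken when the specialised F has odd size. Where the leading coefficient of F
   survives, the size is dim L + 1, which is even, so there is a real root. *)
have rho_ex (e : {rmorphism D -> R}) :
    exists x, ~~ odd (size (map_poly e F)) ==> root (map_poly e F) x.
  by case: (boolP (odd _)) => [|/odd_poly_root[x rx]]; [exists 0 | exists x].
pose rho e := xchoose (rho_ex e); exists rho.
have rhoP (e : {rmorphism D -> R}) : e (lead_coef F) != 0 -> eval2 e (rho e) F = 0.
  move=> eF; have /implyP := xchooseP (rho_ex e); rewrite -/(rho e) => e_root.
  by apply/rootP/e_root; rewrite size_map_poly_id0 // szF /= negbK.
(* The minimal polynomial divides P; after clearing denominators, F divides a nonzero constant of D
   times P. *)
have vanish P : eval2 frac_alg theta P = 0 ->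
    exists2 b : D, b != 0 & forall e : {rmorphism D -> R}, e b != 0 -> eval2 e (rho e) P = 0.
  rewrite eval2E /frac_alg map_poly_comp => /rootP.
  move/(minPoly_dvdp (alg_polyOver 1 _)); rewrite mE dvdp_map => /divpK PE.
  have [q [U [q_neq0 UE]]] := clear_denominators (map_poly (@tofrac D) P %/ m).
  have {}PE : (q * q0) *: P = U * F.
    apply: map_tofrac_inj; rewrite rmorphM /= -UE -FE map_polyZ -[in LHS]PE rmorphM /=.
    by rewrite -scalerAr -scalerAl scalerA [_ * tofrac q]mulrC.
  exists (q * q0 * lead_coef F).
    by rewrite !mulf_neq0 // lead_coef_eq0 -size_poly_eq0 szF.
  move=> e; rewrite rmorphM mulf_eq0 negb_or => /andP[eq eF].
  have := congr1 (eval2 e (rho e)) PE; rewrite rmorphM rhoP // mulr0 -mul_polyC rmorphM eval2C.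
  by move/eqP; rewrite mulf_eq0 (negPf eq) => /eqP.
move=> P; case: eqP => [P0|/eqP P0].
  by have [b b0 bP] := vanish P P0; exists b => // e /bP ->; rewrite eqxx.
(* For the converse, write the inverse of P(theta) as U(theta)/q. Then P U - q vanishes at theta,
   hence at the real root, so P can vanish there only where q does. *)
have [q [U [q_neq0 UE]]] := repr (eval2 frac_alg theta P)^-1.
have [|b b_neq0 bP] := vanish (P * U - q%:P).
  by rewrite rmorphB rmorphM eval2C -UE mulrCA mulfV // mulr1 subrr.
exists (b * q); first exact: mulf_neq0.
move=> e; rewrite rmorphM mulf_eq0 negb_or => /andP[eb eq].
apply/negP => /eqP eP0; have := bP e eb; rewrite rmorphB rmorphM eP0 mul0r eval2C sub0r.
by move/eqP; rewrite oppr_eq0 (negPf eq).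
Qed.

End Specialization.

(** * Real estimates *)

Section RealEstimates.

Variables (R : realFieldType) (I : eqType).
Implicit Types (r : seq I) (a b x y : I -> R).

Lemma sum_sqr_ge0 r x : 0 <= \sum_(i <- r) x i ^+ 2.
Proof. by apply: sumr_ge0 => i _; apply: sqr_ge0. Qed.

Lemma cauchy_schwarz_sum r (P : pred I) a b :
  (\sum_(i <- r | P i) a i * b i) ^+ 2 <=
  (\sum_(i <- r | P i) a i ^+ 2) * (\sum_(i <- r | P i) b i ^+ 2).
Proof.
suff [] : [/\ 0 <= \sum_(i <- r | P i) a i ^+ 2, 0 <= \sum_(i <- r | P i) b i ^+ 2 &
    (\sum_(i <- r | P i) a i * b i) ^+ 2 <=
      (\sum_(i <- r | P i) a i ^+ 2) * (\sum_(i <- r | P i) b i ^+ 2)] by [].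
elim: r => [|i r]; first by rewrite !big_nil expr0n mul0r.
rewrite !big_cons; case: (P i) => //.
move: (\sum_(j <- r | P j) a j * b j) (\sum_(j <- r | P j) a j ^+ 2) => p A.
move: (\sum_(j <- r | P j) b j ^+ 2) => B [A0 B0 pAB].
set u := a i; set v := b i.
split; [exact: addr_ge0 (sqr_ge0 _) A0 | exact: addr_ge0 (sqr_ge0 _) B0 |].
(* The square of the right side is at least 4 A B u^2 v^2, hence at least 4 u^2 v^2 p^2. *)
have : 2 * (u * v * p) <= A * v ^+ 2 + B * u ^+ 2.
  have uB : 0 <= B * u ^+ 2 by rewrite mulr_ge0 ?sqr_ge0.
  have vA : 0 <= A * v ^+ 2 by rewrite mulr_ge0 ?sqr_ge0.
  apply: le_trans (ler_norm _) _; rewrite -(@ler_pXn2r _ 2) ?nnegrE ?addr_ge0 //.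
  rewrite real_normK ?num_real //.
  have := ler_wpM2l (sqr_ge0 (u * v)) pAB.
  have := sqr_ge0 (A * v ^+ 2 - B * u ^+ 2); lra.
nra.
Qed.

Lemma sum_expr4_le r x :
  0 <= \sum_(i <- r) x i ^+ 4 <= (\sum_(i <- r) x i ^+ 2) ^+ 2.
Proof.
suff [_ ? ?] : [/\ 0 <= \sum_(i <- r) x i ^+ 2, 0 <= \sum_(i <- r) x i ^+ 4 &
    \sum_(i <- r) x i ^+ 4 <= (\sum_(i <- r) x i ^+ 2) ^+ 2] by apply/andP.
elim: r => [|i r]; first by rewrite !big_nil expr0n.
rewrite !big_cons; move: (\sum_(j <- r) x j ^+ 2) (\sum_(j <- r) x j ^+ 4) => S Q [S0 Q0 QS].
have x2 := sqr_ge0 (x i).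
have x4 : x i ^+ 4 = x i ^+ 2 * x i ^+ 2 by rewrite -exprD.
by rewrite x4; split; nra.
Qed.

(** Write Q and Y for the sums of x_i^4 and y_i^4. Since x^4 + x^3 y + y^4 >= 0, the mixed sum is at
    least -(Q + Y), and the equation gives S^2 - Q <= e Q - (1 - e) Y - Z, with Q <= S^2. If S = 0
    then Q = 0, and so Y = Z = 0. *)
Lemma quartic_real_bound r x y (e Z : R) : 0 < e < 1 -> 0 <= Z ->
  let S := \sum_(i <- r) x i ^+ 2 in
  S ^+ 2 - \sum_(i <- r) x i ^+ 4 + \sum_(i <- r) y i ^+ 4
    + e * (\sum_(i <- r) x i ^+ 3 * y i) + Z = 0 ->
  S ^+ 2 - \sum_(i <- r) x i ^+ 4 <= e * S ^+ 2 /\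
  (S = 0 -> (forall i, i \in r -> y i = 0) /\ Z = 0).
Proof.
move=> /andP[e0 e1] Z0 S.
have [Q0 QS] := andP (sum_expr4_le r x); have [Y0 _] := andP (sum_expr4_le r y).
have : - (\sum_(i <- r) x i ^+ 4 + \sum_(i <- r) y i ^+ 4) <= \sum_(i <- r) x i ^+ 3 * y i.
  rewrite -big_split -sumrN; apply: ler_sum => i _.
  have h1 : 0 <= x i ^+ 2 * (x i + y i) ^+ 2 by rewrite mulr_ge0 ?sqr_ge0.
  have h2 := sqr_ge0 (x i ^+ 2 - y i ^+ 2).
  have h3 := sqr_ge0 (x i ^+ 2); have h4 := sqr_ge0 (y i ^+ 2).
  rewrite /=; lra.
move: Q0 QS Y0; rewrite -/S.
set Q := \sum_(i <- r) x i ^+ 4; set Y := \sum_(i <- r) y i ^+ 4; set P := \sum_(i <- r) _.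
move=> Q0 QS Y0 PQY E.
have eP : - (e * (Q + Y)) <= e * P by rewrite -mulrN ler_pM2l.
split; first by nra.
move=> S0; rewrite S0 expr0n /= in QS E.
have Q_eq0 : Q = 0 by lra.
have Y_eq0 : Y = 0 by nra.
split; last by nra.
move=> i ir; move/eqP: Y_eq0; rewrite psumr_eq0 => [/allP/(_ i ir)|j _].
  by rewrite expf_eq0 /= => /eqP.
by rewrite (exprM _ 2 2) sqr_ge0.
Qed.

(* Some x_i^2 exceeds (1 - e) S, so the relation sum_j c_j x_j = 0 forces c_i to be small. *)
Lemma concentrated_relation r x (c : I -> R) (e : R) : uniq r -> 0 < e < 1 ->
  let S := \sum_(i <- r) x i ^+ 2 in
  0 < S -> S ^+ 2 - \sum_(i <- r) x i ^+ 4 <= e * S ^+ 2 ->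
  \sum_(i <- r) c i * x i = 0 ->
  exists2 i, i \in r & c i ^+ 2 <= e * (\sum_(j <- r) c j ^+ 2 + c i ^+ 2).
Proof.
move=> r_uniq /andP[e0 e1] S S0 SQ cx.
(* Otherwise every term of sum_i x_i^2 ((1 - e) S - x_i^2) is nonnegative, while the sum is (1 - e)
   S^2 - sum_i x_i^4 <= 0; so all x_i would vanish. *)
have [i ir xi] : exists2 i, i \in r & (1 - e) * S <= x i ^+ 2.
  apply/hasP/negPn/negP => /hasPn small.
  have Sx : \sum_(i <- r) x i ^+ 2 * ((1 - e) * S - x i ^+ 2) <= 0.
    under eq_bigr => i _ do rewrite mulrBr -exprD.
    by rewrite sumrB -mulr_suml -/S; nra.
  have x0 i : i \in r -> x i = 0.
    move=> ir; apply/eqP; rewrite -sqrf_eq0; apply/negPn/negP => xi0.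
    have ge0 j : j \in r -> 0 <= x j ^+ 2 * ((1 - e) * S - x j ^+ 2).
      by move=> /small; rewrite -ltNge => /ltW ?; rewrite mulr_ge0 ?sqr_ge0 // subr_ge0.
    move: Sx; rewrite (bigD1_seq i) //= leNgt => /negP; apply.
    rewrite ltr_pwDl //.
      by rewrite mulr_gt0 //; [rewrite lt_def xi0 sqr_ge0 | rewrite subr_gt0 ltNge small].
    by rewrite big_seq_cond; apply: sumr_ge0 => j /andP[/ge0].
  by move: S0; rewrite /S big_seq big1 ?ltxx // => j /x0 ->; rewrite expr0n.
exists i => //; have SE : S = x i ^+ 2 + \sum_(j <- r | j != i) x j ^+ 2.
  by rewrite /S (bigD1_seq i).
have CE : \sum_(j <- r) c j ^+ 2 = c i ^+ 2 + \sum_(j <- r | j != i) c j ^+ 2.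
  by rewrite (bigD1_seq i).
have := cauchy_schwarz_sum r (fun j => j != i) c x.
have -> : \sum_(j <- r | j != i) c j * x j = - (c i * x i).
  by apply/eqP; rewrite -addr_eq0 addrC -(bigD1_seq i) //= cx.
have C0 : 0 <= \sum_(j <- r | j != i) c j ^+ 2 by apply: sumr_ge0 => j _; apply: sqr_ge0.
have X0 : 0 <= \sum_(j <- r | j != i) x j ^+ 2 by apply: sumr_ge0 => j _; apply: sqr_ge0.
rewrite CE; move: C0 X0 SE; set C := \sum_(j <- r | j != i) c j ^+ 2.
set X := \sum_(j <- r | j != i) x j ^+ 2 => C0 X0 SE.
rewrite sqrrN exprMn => cs; have c2 := sqr_ge0 (c i).
have Xe : X <= e * S by lra.
have h1 : c i ^+ 2 * ((1 - e) * S) <= C * (e * S).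
  apply: le_trans (ler_wpM2l c2 xi) _; apply: le_trans cs _; exact: ler_wpM2l.
have : c i ^+ 2 * (1 - e) <= C * e by rewrite -(ler_pM2r S0); lra.
nra.
Qed.

End RealEstimates.

(** Write b = q X^m with q(0) nonzero. By continuity q^2 and all members of [hs] stay positive on
    some interval to the right of 0, where X^m does not vanish either. *)
Lemma small_positive_parameter (R : rcfType) (hs : seq {poly R}) (b : {poly R}) :
  (forall h, h \in hs -> 0 < h.[0]) -> b != 0 ->
  exists2 e, 0 < e < 1 & b.[e] != 0 /\ forall h, h \in hs -> 0 < h.[e].
Proof.
move=> hs0 b0; have [m [q /implyP/(_ b0) q0 bE]] := multiplicity_XsubC b 0.
have [delta delta0 deltaP] : exists2 delta : R, 0 < delta &
    forall y, 0 < y < delta -> forall h, h \in q ^+ 2 :: hs -> 0 < h.[y].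
  have : forall h, h \in q ^+ 2 :: hs -> 0 < h.[0].
    move=> h; rewrite inE => /orP[/eqP ->|/hs0//].
    by rewrite horner_exp lt_def sqr_ge0 expf_neq0.
  elim: (q ^+ 2 :: hs) => [_|h hs' IH h0]; first by exists 1.
  have [|d1 d1_gt0 d1P] := IH; first by move=> g gh; apply: h0; rewrite inE gh orbT.
  have hh0 := h0 h (mem_head _ _).
  have [d2 d2_gt0 d2P] := poly_cont 0 h hh0.
  exists (Num.min d1 d2); first by rewrite lt_min d1_gt0.
  move=> y /andP[y0]; rewrite lt_min => /andP[y1 y2] g; rewrite inE => /orP[/eqP ->|gh].
    have := d2P y; rewrite subr0 gtr0_norm // => /(_ y2); rewrite ltr_distl => /andP[].
    by rewrite subrr.
  by apply: d1P => //; rewrite y0.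
pose e := Num.min delta 1 / 2.
have m0 : 0 < Num.min delta 1 by rewrite lt_min delta0 ltr01.
have e0 : 0 < e by rewrite divr_gt0.
have e_lt : e < Num.min delta 1 by rewrite /e; lra.
move: (e_lt); rewrite lt_min => /andP[ed e1].
have eP := deltaP e (introT andP (conj e0 ed)).
exists e; first by rewrite e0.
split; last by move=> h hh; apply: eP; rewrite inE hh orbT.
rewrite bE hornerM horner_exp hornerXsubC subr0 mulf_neq0 ?expf_neq0 //; last exact: lt0r_neq0.
have /lt0r_neq0 := eP _ (mem_head _ _); by rewrite horner_exp expf_eq0.
Qed.

Lemma block_scale (S : comNzRingType) N e d (a : S) (v : 'I_N -> S) :
  block e d (fun i => a * v i) = a *: block e d v.
Proof. by rewrite /block scaler_sumr; apply: eq_bigr => i _; rewrite scalerA. Qed.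

Lemma quartic_scale (S : comNzRingType) d N (t a : S) (v : 'I_N -> S) :
  quartic d t (fun i => a * v i) = a ^+ 4 * quartic d t v.
Proof.
rewrite /quartic !block_scale !exprZn -scalerAl -scalerAr scalerA !ptraceZ.
have -> : quartic_tail d (fun i => a * v i) = a ^+ 4 * quartic_tail d v.
  by rewrite /quartic_tail mulr_sumr; apply: eq_bigr => i _; rewrite exprMn.
ring.
Qed.

Definition evalt (R : rcfType) (e : R) : {rmorphism {poly rat} -> R} :=
  (horner_eval e \o map_poly (ratr : rat -> R)).

Section RealSpecialization.

Variables (d N : nat) (R : rcfType) (r : seq R).
Hypotheses (d_gt0 : (0 < d)%N) (r_uniq : uniq r) (r_size : size r = d)
  (fE : map_poly intr (fpoly d) = \prod_(a <- r) ('X - a%:P)).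

Lemma ptrace_real_roots (g : {poly R}) : ptrace (fpoly d) g = \sum_(a <- r) g.[a].
Proof. by apply: ptrace_roots fE => //; [rewrite r_size | exact: fpoly_monic]. Qed.

Lemma real_quartic_zero (e : R) (w : 'I_N -> R) (c : {poly R}) :
  0 < e < 1 -> quartic d e w = 0 -> (exists i, w i != 0) ->
  ptrace (fpoly d) (c * block 0 d w) = 0 ->
  exists2 a, a \in r & c.[a] ^+ 2 <= e * (\sum_(b <- r) c.[b] ^+ 2 + c.[a] ^+ 2).
Proof.
move=> e01 w0 [i0 wi0] cA0.
set A := block 0 d w in cA0; pose B := block d d w; pose Z := quartic_tail d w.
have w0E : (\sum_(a <- r) A.[a] ^+ 2) ^+ 2 - \sum_(a <- r) A.[a] ^+ 4
    + \sum_(a <- r) B.[a] ^+ 4 + e * (\sum_(a <- r) A.[a] ^+ 3 * B.[a]) + Z = 0.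
  rewrite -[RHS]w0 /quartic !ptrace_real_roots -/A -/B -/Z.
  by congr (_ ^+ 2 - _ + _ + _ * _ + _); apply: eq_bigr => a _; rewrite ?hornerM ?horner_exp.
have cA : \sum_(a <- r) c.[a] * A.[a] = 0.
  by rewrite -[RHS]cA0 ptrace_real_roots; apply: eq_bigr => a _; rewrite hornerM.
have w4 i : 0 <= w i ^+ 4 by rewrite (exprM _ 2 2) sqr_ge0.
have Z0 : 0 <= Z by apply: sumr_ge0 => i _.
have [SQ S_eq0] := quartic_real_bound e01 Z0 w0E.
apply: (concentrated_relation r_uniq e01) cA => //.
(* S = 0 would annihilate A, B and the tail, hence every coordinate of w. *)
rewrite lt_def sum_sqr_ge0 andbT; apply/negP => /eqP S0.
have [B0 Z_eq0] := S_eq0 S0; case/negP: wi0; apply/eqP.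
have B_eq0 : B = 0.
  by apply: (size_le_roots_eq0 r_uniq) => //; rewrite r_size size_block.
have A_eq0 : A = 0.
  apply: (size_le_roots_eq0 r_uniq) => [|a ar]; first by rewrite r_size size_block.
  move/eqP: S0; rewrite psumr_eq0 => [/allP/(_ a ar)|b _]; last exact: sqr_ge0.
  by rewrite sqrf_eq0 => /eqP.
have [i0d|di0] := ltnP i0 d.
  by rewrite -(@coef_block _ _ 0 d w i0) // -/A A_eq0 coef0.
have [i0d|d2i0] := ltnP i0 (d + d).
  by rewrite -(@coef_block _ _ d d w i0) ?di0 // -/B B_eq0 coef0.
move/eqP: Z_eq0; rewrite psumr_eq0 // => /allP/(_ i0 (mem_index_enum _)).
by rewrite mul2n -addnn d2i0 expf_eq0 /= => /eqP.
Qed.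

End RealSpecialization.

(** * Points of odd degree *)

(** Dividing by the largest power of the parameter leaves a polynomial that is nonzero at parameter
    0; [swapXY] makes the parameter the outer variable, where multiplicities are available. *)
Lemma poly_param_primitive (F : fieldType) (U : {poly {poly F}}) : U != 0 ->
  exists m V, U = V * ('X^m)%:P /\ map_poly (horner_eval 0) V != 0.
Proof.
move=> U0; have [m [q qE]] := multiplicity_XsubC (swapXY U) 0.
have W0 : swapXY U != 0 by rewrite swapXY_eq0.
move: qE; rewrite W0 /= => q0 qE; exists m, (swapXY q).
split; first by rewrite -[U]swapXYK qE rmorphM rmorphXn /= subr0 swapXY_X rmorphXn.
by rewrite -horner_swapXY swapXYK polyC0.
Qed.

(** The d elements Tr(X^i A) of L are linearly independent: a relation with coefficients u_i is,
    after clearing denominators, Tr(U A) = 0 with U over D. *)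
Lemma dim_ge_ptrace_independent (D : idomainType) (L : fieldExtType {fraction D})
    (f : {poly int}) (A : {poly L}) d :
  (forall U : {poly D}, (size U <= d)%N -> U != 0 ->
     ptrace f (map_poly (frac_alg L) U * A) != 0) ->
  (d <= \dim {: L})%N.
Proof.
move=> indep; pose X := [tuple ptrace f ('X^i * A) | i < d].
suff /eqP : free X by rewrite size_tuple => <-; exact/dimvS/subvf.
apply/freeP => k k0 i; apply/eqP/negPn/negP => ki0.
pose u : {poly {fraction D}} := \poly_(j < d) (if insub j is Some j' then k j' else 0).
have ui (j : 'I_d) : u`_j = k j by rewrite coef_poly ltn_ord valK.
have u0 : u != 0 by apply/eqP => u0; move: ki0; rewrite -ui u0 coef0 eqxx.
have [q [U [q0 UE]]] := clear_denominators u.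
have Uj j : tofrac U`_j = tofrac q * u`_j :> {fraction D}.
  by rewrite -coefZ UE coef_map.
have szU : (size U <= d)%N.
  apply/leq_sizeP => j dj; apply/eqP; rewrite -tofrac_eq0 Uj nth_default ?mulr0 //.
  by rewrite (leq_trans (size_poly _ _)).
have U0 : U != 0.
  apply: contra_neq u0 => U0; apply/eqP; rewrite -(inj_eq (scalerI (_ : tofrac q != 0))).
    by rewrite UE U0 rmorph0 scaler0.
  by rewrite tofrac_eq0.
case/negP: (indep U szU U0); apply/eqP.
have -> : map_poly (frac_alg L) U = \sum_(j < d) frac_alg L U`_j *: 'X^j.
  rewrite -(poly_def d (fun j => frac_alg L U`_j)); apply/polyP => j; rewrite coef_map coef_poly.
  case: ltnP => // dj; have -> : U`_j = 0 by rewrite nth_default // (leq_trans szU).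
  exact: rmorph0.
rewrite mulr_suml (big_morph (ptrace f (S := L)) (@ptraceD f _) (ptrace0 f _)).
rewrite -[RHS](scaler0 _ (tofrac q)) -[in RHS]k0 scaler_sumr; apply: eq_bigr => j _.
rewrite -scalerAl ptraceZ -tnth_nth tnth_mktuple scalerA -ui -Uj.
exact: mulr_algl.
Qed.

Lemma clear_coordinates (D : idomainType) (L : fieldExtType {fraction D}) (theta : L) N
    (v : 'I_N -> L) :
  (forall x : L, exists q P, q != 0 /\ frac_alg L q * x = eval2 (frac_alg L) theta P) ->
  exists q (P : 'I_N -> {poly D}),
    q != 0 /\ forall i, eval2 (frac_alg L) theta (P i) = frac_alg L q * v i.
Proof.
move=> repr; have [q qP] := fin_all_exists (fun i => repr (v i)).
have [P PE] := fin_all_exists qP.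
exists (\prod_j q j), (fun i => (\prod_(j | j != i) q j)%:P * P i); split.
  by apply/prodf_neq0 => j _; case: (PE j).
move=> i; have [_ Pi] := PE i.
rewrite rmorphM eval2C -Pi mulrA -rmorphM [in RHS](bigD1 i) //=.
by congr (frac_alg L _ * _); exact: mulrC.
Qed.

(** At t = 0 the coefficients become rational, so the irreducibility of f over Q applies. *)
Lemma evalt0E (R : rcfType) (V : {poly {poly rat}}) :
  map_poly (evalt (0 : R)) V = map_poly ratr (map_poly (horner_eval 0) V).
Proof.
rewrite -map_poly_comp; apply: eq_map_poly => p /=.
by rewrite /evalt /= /horner_eval -[in LHS](rmorph0 (ratr : rat -> R)) horner_map.
Qed.

(** For fixed real a, the value at a of the specialisation of V at t = e is a polynomial function of
    e; this makes continuity at e = 0 usable. *)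
Lemma horner_evalt (R : rcfType) (V : {poly {poly rat}}) (e a : R) :
  (map_poly (map_poly ratr) V).[a%:P].[e] = (map_poly (evalt e) V).[a].
Proof.
have <- : map_poly (horner_eval e) (map_poly (map_poly ratr) V) = map_poly (evalt e) V.
  by rewrite -map_poly_comp; apply: eq_map_poly.
have := horner_map (horner_eval e) (map_poly (map_poly (ratr : rat -> R)) V) a%:P.
by rewrite /= {2}/horner_eval hornerC => ->.
Qed.

(** The irreducible f does not divide c, which is nonzero of smaller degree, so they are coprime and
    share no root. *)
Lemma fpoly_root_neq0 d (R : rcfType) (c : {poly rat}) (a : R) : (0 < d)%N ->
  c != 0 -> (size c <= d)%N -> root (map_poly intr (fpoly d)) a ->
  (map_poly ratr c).[a] != 0.
Proof.
move=> d_gt0 c0 szc fa; have fmon := fpoly_monic d_gt0.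
have cop : coprimep (map_poly intr (fpoly d)) c.
  rewrite irreducible_poly_coprime; last exact: fpoly_irreducible.
  apply/negP => /(dvdp_leq c0).
  by rewrite size_map_poly_id0 ?size_fpoly ?(monicP fmon) ?oner_neq0 // ltnNge szc.
have := cop; rewrite -(coprimep_map (ratr : {rmorphism rat -> R})) => /coprimep_root; apply.
rewrite -map_poly_comp (_ : map_poly _ _ = map_poly intr (fpoly d)) //.
by apply: eq_map_poly => x /=; rewrite ratr_int.
Qed.

Lemma evalt_X (R : rcfType) (e : R) : evalt e 'X = e.
Proof. by rewrite /evalt /= map_polyX /horner_eval hornerX. Qed.

Lemma ptrace_map_eval2 (D : idomainType) (S : comNzRingType) (f : {poly int})
    (h : {rmorphism D -> S}) (x : S) (V : {poly D}) (A : {poly {poly D}}) :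
  eval2 h x (ptrace f (map_poly polyC V * A)) =
  ptrace f (map_poly h V * map_poly (eval2 h x) A).
Proof.
rewrite -ptrace_map; congr ptrace; rewrite rmorphM /= -map_poly_comp; congr (_ * _).
by apply: eq_map_poly => c; exact: eval2C.
Qed.

Lemma no_small_odd_point (R : rcfType) d N (L : fieldExtType Qt) : (0 < d)%N ->
  odd (\dim {: L}) -> has_point L (quartic_form d N) -> (d <= \dim {: L})%N.
Proof.
move=> d_gt0 L_odd [v0 [[i0 v0i0] v0_zero]].
have L_char : [pchar L] =i pred0 by exact: (pchar_Qt_ext (in_alg L)).
have [theta [repr [rho rhoP]]] := real_specialization R L_char L_odd.
set psi := eval2 (frac_alg L) theta in repr rhoP.
have [q0 [P [q0_neq0 PE]]] := clear_coordinates v0 repr.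
pose v i := psi (P i).
have fq0 : frac_alg L q0 != 0 by rewrite fmorph_eq0 tofrac_eq0.
have vi0 : v i0 != 0 by rewrite /v PE mulf_neq0.
have v_zero : quartic d (frac_alg L 'X) v = 0.
  rewrite (quartic_ext _ _ (PE : v =1 fun i => frac_alg L q0 * v0 i)) quartic_scale.
  by rewrite -[X in _ * X](meval_quartic_form (in_alg L)) v0_zero mulr0.
apply: (@dim_ge_ptrace_independent _ L (fpoly d) (block 0 d v)) => U szU U0.
(* Stripping powers of t keeps the relation nontrivial at t = 0. *)
apply/negP => /eqP UA0; have [m [V [UV V0]]] := poly_param_primitive U0.
have UV' : map_poly (frac_alg L) U = frac_alg L 'X^m *: map_poly (frac_alg L) V.
  by rewrite UV rmorphM /= map_polyC mulrC mul_polyC.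
have fX : frac_alg L 'X^m != 0 by rewrite fmorph_eq0 tofrac_eq0 monic_neq0 ?monicXn.
have VA0 : ptrace (fpoly d) (map_poly (frac_alg L) V * block 0 d v) = 0.
  move/eqP: UA0; rewrite UV' -scalerAl ptraceZ mulf_eq0 (negPf fX) /= => /eqP //.
have szV : (size V <= d)%N.
  apply/leq_sizeP => j dj; have := nth_default 0 (leq_trans szU dj).
  rewrite UV mulrC mul_polyC coefZ => /eqP; rewrite mulf_eq0 => /orP[|/eqP //].
  by rewrite (negPf (monic_neq0 (monicXn _ _))).
have [r [r_uniq szr fE]] := fpoly_totally_real R d_gt0.
(* [g a] is V(a) as a polynomial in t. Positivity of [h a] at t = e contradicts the inequality of
   [real_quartic_zero]; at t = 0 it only says that [g a] is nonzero there. *)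
pose g (a : R) := (map_poly (map_poly ratr) V).[a%:P].
pose h a := g a ^+ 2 - 'X * (\sum_(b <- r) g b ^+ 2 + g a ^+ 2).
have hE a x : (h a).[x] = (g a).[x] ^+ 2 - x * (\sum_(b <- r) (g b).[x] ^+ 2 + (g a).[x] ^+ 2).
  rewrite /h hornerD hornerN horner_exp hornerM hornerX hornerD horner_sum horner_exp.
  by under eq_bigr => b _ do rewrite horner_exp.
have g0 a : a \in r -> (g a).[0] != 0.
  move=> ar; rewrite /g horner_evalt evalt0E; apply: (fpoly_root_neq0 d_gt0 V0).
    by rewrite (leq_trans (size_poly _ _)).
  by rewrite fE root_prod_XsubC.
have h0 p : p \in [seq h a | a <- r] -> 0 < p.[0].
  by case/mapP => a ar ->; rewrite hE mul0r subr0 lt_def sqrf_eq0 g0 // sqr_ge0.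
(* Three facts must survive specialisation: the quartic equation, the trace relation, and the
   nonvanishing of coordinate i0. *)
have [b1 b1_neq0 b1P] := rhoP (quartic d 'X%:P P).
have [b2 b2_neq0 b2P] := rhoP (ptrace (fpoly d) (map_poly polyC V * block 0 d P)).
have [b3 b3_neq0 b3P] := rhoP (P i0).
have b_neq0 : map_poly ratr (b1 * b2 * b3) != 0 :> {poly R}.
  by rewrite map_poly_eq0 !mulf_neq0.
have [e e01 [be he]] := small_positive_parameter h0 b_neq0.
have [be1 be2 be3] : [/\ evalt e b1 != 0, evalt e b2 != 0 & evalt e b3 != 0].
  have : evalt e (b1 * b2 * b3) != 0 by exact: be.
  by rewrite !rmorphM !mulf_eq0 !negb_or => /andP[/andP[-> ->] ->].
pose phi := eval2 (evalt e) (rho (evalt e)); pose w i := phi (P i).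
have w_zero : quartic d e w = 0.
  have := b1P _ be1; rewrite -/phi -(quartic_map psi) /psi eval2C v_zero eqxx => /eqP.
  by rewrite -(quartic_map phi) /phi eval2C evalt_X.
have wi0 : w i0 != 0 by rewrite /w b3P.
have Vw0 : ptrace (fpoly d) (map_poly (evalt e) V * block 0 d w) = 0.
  have := b2P _ be2; rewrite /psi !ptrace_map_eval2 -!block_map VA0 eqxx => /eqP.
  by [].
have [a ar] := real_quartic_zero d_gt0 r_uniq szr fE e01 w_zero (ex_intro _ i0 wi0) Vw0.
apply/negP; rewrite -ltNge -subr_gt0; have := he (h a) (map_f h ar).
rewrite hE /g horner_evalt.
by under eq_bigr => b _ do rewrite horner_evalt.
Qed.

(** * Irreducibility over the rational function field, and the conclusion *)

Lemma exists_nonroot (R : numDomainType) (p : {poly R}) : p != 0 -> exists x, p.[x] != 0.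
Proof.
move=> p0; pose s := [seq k%:R : R | k <- iota 0 (size p)].
have : ~~ all (root p) s.
  apply: contra p0 => p_s; apply/eqP/(roots_geq_poly_eq0 p_s); last by rewrite size_map size_iota.
  by rewrite map_inj_uniq ?iota_uniq // => i j /eqP; rewrite eqr_nat => /eqP.
by case/allPn => x _ px; exists x.
Qed.

(** Clear denominators in a factorisation and evaluate the parameter at a point x where neither the
    denominators nor the leading coefficient of U vanish: this gives a factor of p over F of the
    same degree as q. *)
Lemma irreducible_fraction_poly (F : numFieldType) (p : {poly F}) : irreducible_poly p ->
  irreducible_poly (map_poly (@tofrac {poly F} \o polyC) p).
Proof.
move=> [p_gt1 p_irr]; set pt := map_poly _ p.
have szpt : size pt = size p.
  by apply: size_map_inj_poly; rewrite ?rmorph0 // => x y /tofrac_inj/polyC_inj.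
have p0 : p != 0 by rewrite -size_poly_gt0 ltnW.
have ptE : pt = map_poly (@tofrac _) (map_poly polyC p) by rewrite -map_poly_comp.
split; first by rewrite szpt.
move=> q q_neq1 /[dup] q_dvd /divpK q_mul; set q' := pt %/ q in q_mul.
have [a [U [a0 UE]]] := clear_denominators q; have [b [V [b0 VE]]] := clear_denominators q'.
have UV : (a * b) *: map_poly polyC p = U * V.
  apply: map_tofrac_inj; rewrite rmorphM /= -UE -VE map_polyZ -ptE -q_mul rmorphM /=.
  by rewrite -scalerAr -scalerAl scalerA [q * q']mulrC [tofrac b * _]mulrC.
have p_neq0 : map_poly polyC p != 0 :> {poly {poly F}}.
  by rewrite map_poly_eq0_id0 // polyC_eq0 lead_coef_eq0.
have UV0 : U * V != 0 by rewrite -UV -mul_polyC mulf_neq0 // polyC_eq0 mulf_neq0.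
move: (UV0); rewrite mulf_eq0 negb_or => /andP[U0 V0].
have szU : size U = size q.
  rewrite -(size_scale q (a := tofrac a)) ?tofrac_eq0 // UE size_map_inj_poly ?rmorph0 //.
  exact: tofrac_inj.
have [x] : exists x, (a * b * lead_coef U).[x] != 0.
  by apply: exists_nonroot; rewrite !mulf_neq0 // lead_coef_eq0.
rewrite !hornerM !mulf_eq0 !negb_or => /andP[/andP[ax bx] Ux].
pose ev := map_poly (horner_eval x).
have szUx : size (ev U) = size q by rewrite size_map_poly_id0.
have UVx : (a.[x] * b.[x]) *: p = ev U * ev V.
  rewrite /ev -rmorphM -UV /= map_polyZ /= {1}/horner_eval hornerM -map_poly_comp.
  by rewrite [in RHS]map_poly_id // => y _; rewrite /= /horner_eval hornerC.
have Up : ev U %| p.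
  by rewrite -(dvdpZr _ _ (_ : a.[x] * b.[x] != 0)) ?mulf_neq0 // UVx dvdp_mulr.
have := p_irr _ _ Up; rewrite szUx => /(_ q_neq1) /eqp_size; rewrite szUx => szq.
by rewrite -dvdp_size_eqp // szq szpt.
Qed.

Local Close Scope ring_scope.

Theorem mainTheorem5 (d : nat) (d_odd : odd d) :
  exists N : nat, forall n : nat, N <= n ->
  exists H : {mpoly Qt[n.+2]},
    [/\ smooth_hypersurface 4 H,
        exists2 L : fieldExtType Qt, \dim {: L} = d & has_point L H &
        forall L : fieldExtType Qt,
          odd (\dim {: L}) -> \dim {: L} < d -> ~ has_point L H].
Proof.
have d_gt0 : (0 < d)%N by case: d d_odd.
(* For n >= 2 d the n + 2 variables exceed the two blocks, so the Fermat tail is nonempty. *)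
exists (2 * d)%N => n dn; exists (quartic_form d n.+2); split.
- by apply: quartic_form_smooth => //; lia.
(* L is Q(t) with a root of f adjoined. *)
- have := irreducible_fraction_poly (fpoly_irreducible d_gt0).
  set p := map_poly _ _ => /irredp_FAdjoin[L dimL [a pa _]].
  exists L.
    rewrite dimL /p !size_map_inj_poly ?rmorph0 ?size_fpoly //; first exact: intr_inj.
    by move=> x y /tofrac_inj/polyC_inj.
  apply: (@root_fpoly_has_point d n.+2 L a) => //; first by lia.
  rewrite (_ : map_poly intr (fpoly d) = map_poly (in_alg L) p) //.
  rewrite /p -!map_poly_comp; apply: eq_map_poly => x.
  exact: esym (rmorph_int (in_alg L \o Qt_const) x).
move=> L L_odd dimL /(no_small_odd_point realalg d_gt0 L_odd).
by rewrite leqNgt dimL.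
Qed.
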